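(* Let $X$ be a compact metric space and let $F:X\to 2^X$ be upper semi-continuous. Let $a,b\in X$ with $a\ne b$. If $\{a,b\}\subseteq F(a)$ and $\{a,b\}\subseteq F(b)$, then $h(F)\ge\log 2$.
   Context: $\mathbb{N}=\{1,2,\ldots\}$. For a compact metric space $X$ with metric $d$, $2^X$ is the set of non-empty compact subsets of $X$. $F:X\to 2^X$ is upper semi-continuous if for every $x\in X$ and every open $V\subseteq X$ containing $F(x)$ there is an open $U\ni x$ with $F(t)\subseteq V$ for all $t\in U$. Entropy: for $n\in\mathbb{N}$, $\mathrm{Orb}_n(X,F)$ is the set of $n$-orbits, i.e. finite sequences $(x_0,\ldots,x_{n-1})$ in $X$ with $x_{i+1}\in F(x_i)$ for $0\le i\le n-2$, with the metric $D(\mathbf{x},\mathbf{y})=\max_{0\le i\le n-1}d(x_i,y_i)$. A subset of a metric space is $\epsilon$-separated if any two of its distinct points are at distance $\ge\epsilon$. $s_{n,\epsilon}(F)$ is the largest cardinality of an $\epsilon$-separated subset of $(\mathrm{Orb}_n(X,F),D)$, and the topological entropy of $F$ is $h(F)=\lim_{\epsilon\to0}\limsup_{n\to\infty}\frac1n\log s_{n,\epsilon}(F)\in[0,\infty]$. *)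

(* Defs.v *)
From mathcomp Require Import all_boot all_order all_algebra.
From mathcomp Require Import finmap.
From mathcomp Require Import all_classical all_reals all_analysis.

Set Implicit Arguments.
Unset Strict Implicit.
Unset Printing Implicit Defensive.

Import Order.TTheory GRing.Theory Num.Theory.
Import numFieldNormedType.Exports.

Local Open Scope classical_set_scope.
Local Open Scope ring_scope.

(* The hyperspace $2^X$. *)
Definition hyperspace (X : topologicalType) : set (set X) :=
  [set K | K !=set0 /\ compact K].
Arguments hyperspace X : clear implicits.

Definition upper_semicontinuous (X : topologicalType) (F : X -> set X) : Prop :=
  forall (x : X) (V : set X), open V -> F x `<=` V ->
    exists U : set X, [/\ open U, U x & forall t, U t -> F t `<=` V].

Definition orbits (X : Type) (F : X -> set X) (n : nat) : set (n.-tuple X) :=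
  [set x | forall i j : 'I_n, j = i.+1 :> nat -> F (tnth x i) (tnth x j)].
Arguments orbits {X} F n.

Definition orbit_dist (R : realType) (X : metricType R) (n : nat)
    (x y : n.-tuple X) : R :=
  \big[Order.max/0]_(i < n) mdist (tnth x i) (tnth y i).

Definition eps_separated (R : realType) (T : Type) (dist : T -> T -> R)
    (eps : R) (A : set T) : Prop :=
  forall x y, A x -> A y -> x <> y -> eps <= dist x y.

(* [counting A] is the cardinality of [A] in [\bar R], [+oo] if [A] is infinite.
   For compact [X] and [0 < eps] the supremum is finite and attained: see
   [sep_num_attained] below. *)
Definition sep_num (R : realType) (X : metricType R) (F : X -> set X)
    (n : nat) (eps : R) : \bar R :=
  ereal_sup [set counting A | A in
    [set A : set (n.-tuple X) |
      A `<=` orbits F n /\ eps_separated (@orbit_dist R X n) eps A]].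

(* The term [n = 0] is irrelevant for the limsup. *)
Definition entropy_at (R : realType) (X : metricType R) (F : X -> set X)
    (eps : R) : \bar R :=
  limn_esup (fun n => ((n%:R)^-1)%:E * lne (sep_num F n eps))%E.

Definition entropy (R : realType) (X : metricType R) (F : X -> set X) : \bar R :=
  lim (entropy_at F eps @[eps --> 0^'+]).

Lemma le_sep_num (R : realType) (X : metricType R) (F : X -> set X) n
    (e1 e2 : R) : e1 <= e2 -> (sep_num F n e2 <= sep_num F n e1)%E.
Proof.
move=> le12; apply: le_ereal_sup => _ [A [AF As] <-]; exists A => //.
by split=> // x y Ax Ay xy; exact: le_trans le12 (As x y Ax Ay xy).
Qed.

Lemma sep_num_ge0 (R : realType) (X : metricType R) (F : X -> set X) n
    (e : R) : (0 <= sep_num F n e)%E.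
Proof.
apply: ereal_sup_ubound; exists set0; last by rewrite /counting asboolT// fset_set0.
by split.
Qed.

Lemma le_entropy_at (R : realType) (X : metricType R) (F : X -> set X)
    (e1 e2 : R) : e1 <= e2 -> (entropy_at F e2 <= entropy_at F e1)%E.
Proof.
move=> le12; rewrite /entropy_at !limn_esup_lim.
apply: lee_lim; [exact: is_cvg_esups|exact: is_cvg_esups|].
apply: nearW => n; apply: ge_ereal_sup => _ [k /= nk <-].
apply: le_trans; last by apply: ereal_sup_ubound; exists k.
apply: lee_wpmul2l; first by rewrite lee_fin invr_ge0.
rewrite lee_lne ?le_sep_num// in_itv/= leey andbT; exact: sep_num_ge0.
Qed.

Lemma eps_separated_card (R : realType) (X : metricType R) n (eps : R) :
  compact [set: X] -> 0 < eps ->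
  exists N : nat, forall A : set (n.-tuple X),
    eps_separated (@orbit_dist R X n) eps A ->
    finite_set A /\ (#|` fset_set A| <= N)%N.
Proof.
move=> cX eps0; have e20 : 0 < eps / 2 by rewrite divr_gt0.
pose G := filter_from [set: {fset X}] (fun E => [set D | E `<=` D]%fset).
have GF : Filter G.
  apply: filter_from_filter; first by exists fset0.
  move=> E E' _ _; exists (E `|` E')%fset => // D /=.
  by rewrite fsubUset => /andP[].
have [D _ cov] : G [set D : {fset X} |
    [set: X] `<=` [set x | exists c : D, ball (val c) (eps / 2) x]].
  have /compact_near_coveringP nc := cX.
  apply: (nc _ G (fun (D : {fset X}) x => exists c : D, ball (val c) (eps / 2) x)).
  move=> x _.
  exists (ball x (eps / 2), [set D : {fset X} | x \in D]).
    split; first exact: nbhsx_ballx.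
    by exists [fset x]%fset => // D /=; rewrite fsub1set.
  by move=> [y D] /= [xy xD]; exists [` xD]%fset.
have /choice[g gP] (x : X) : exists c : D, ball (val c) (eps / 2) x.
  exact: cov (fsubset_refl D) x I.
pose f (x : n.-tuple X) := [ffun i => g (tnth x i)].
exists #|{ffun 'I_n -> D}| => A sA.
have finj : {in A &, injective f}.
  move=> x y; rewrite !inE => Ax Ay fxy; apply: contrapT => xy.
  have := sA x y Ax Ay xy; rewrite leNgt => /negP; apply.
  apply: bigmax_lt => // i _.
  have : ball (tnth x i) eps (tnth y i).
    apply: (@ball_splitr _ _ (val (g (tnth x i)))); first exact: gP.
    by move/ffunP/(_ i): fxy; rewrite !ffunE => ->; exact: gP.
  by rewrite ballEmdist.
have finA : finite_set A.
  by rewrite -(eq_finite_set (inj_card_eq finj)); exact: finite_finset.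
split=> //.
have u : uniq [seq f x | x <- fset_set A].
  rewrite map_inj_in_uniq ?fset_uniq// => x y.
  by rewrite !in_fset_set//; exact: finj.
rewrite cardE -(size_map f); apply: (uniq_leq_size u) => z _.
by rewrite mem_enum.
Qed.

Lemma sep_num_attained (R : realType) (X : metricType R) (F : X -> set X) n
    (eps : R) : compact [set: X] -> 0 < eps ->
  exists A : set (n.-tuple X), [/\ finite_set A, A `<=` orbits F n,
    eps_separated (@orbit_dist R X n) eps A & sep_num F n eps = counting A].
Proof.
move=> cX eps0; have [N NP] := @eps_separated_card R X n eps cX eps0.
pose P m := `[< exists A : set (n.-tuple X), [/\ A `<=` orbits F n,
  eps_separated (@orbit_dist R X n) eps A & #|` fset_set A| = m] >].
have exP : exists m, P m.
  by exists 0%N; apply/asboolP; exists set0; split=> //; rewrite fset_set0.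
have leP m : P m -> (m <= N)%N.
  by move=> /asboolP[A [_ /NP[_ +] <-]].
case: (ex_maxnP exP leP) => m /asboolP[A [AF As Am]] max.
exists A; have [finA _] := NP A As; split=> //.
apply/eqP; rewrite eq_le; apply/andP; split; last first.
  by apply: ereal_sup_ubound; exists A.
apply: ge_ereal_sup => _ [B [BF Bs] <-]; have [finB _] := NP B Bs.
rewrite /counting !asboolT// lee_fin ler_nat Am; apply: max.
by apply/asboolP; exists B.
Qed.

(* The limit in [entropy] exists in [\bar R]. *)
Lemma is_cvg_entropy_at (R : realType) (X : metricType R) (F : X -> set X) :
  cvg (entropy_at F eps @[eps --> 0^'+]).
Proof.
apply: nonincreasing_at_right_is_cvge; apply: nearW => e x y _ _.
exact: le_entropy_at.
Qed.

(* Main.v *)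
Require Import Defs.
From mathcomp Require Import all_boot all_order all_algebra.
From mathcomp Require Import finmap.
From mathcomp Require Import all_classical all_reals all_analysis.

Set Implicit Arguments.
Unset Strict Implicit.
Unset Printing Implicit Defensive.

Import Order.TTheory GRing.Theory Num.Theory.
Import numFieldNormedType.Exports.

Local Open Scope classical_set_scope.
Local Open Scope ring_scope.

(** Since both [F a] and [F b] contain [a] and [b], every word over the
    two-letter alphabet [{a, b}] is an orbit: the full shift on two symbols sits
    inside the orbit space ([word_orbit]). Two distinct words differ at some
    letter, where the distance is exactly [mdist a b], so the [2 ^ n] words of
    length [n] are [mdist a b]-separated ([word_separated]). Hence
    [sep_num F n eps] is at least [2 ^ n] for all [eps <= mdist a b]
    ([sep_num_ge_expn2]). A family of separated sets growing like [q ^ n] forces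
    entropy at least [ln q] at scale [eps] ([entropy_at_ge_ln]), and this bound
    with [q = 2], being uniform in all small [eps], passes to the limit. *)

(** A finite coding of separated orbits. Injectivity is asked separately, since
    for [eps <= 0] separation does not make distinct codes give distinct
    orbits. *)
Lemma sep_num_ge_card (R : realType) (X : metricType R) (F : X -> set X)
    (n : nat) (eps : R) (T : finType) (f : T -> n.-tuple X) :
  injective f -> (forall t, orbits F n (f t)) ->
  (forall s t, s != t -> eps <= orbit_dist (f s) (f t)) ->
  ((#|T|%:R)%:E <= sep_num F n eps)%E.
Proof.
move=> finj forb fsep; apply: ereal_sup_ubound; exists (range f) => /=.
  split=> [_ [t _ <-]|_ _ [s _ <-] [t _ <-] st]; first exact: forb.
  by apply: fsep; apply: contra_notN st => /eqP ->.
have finT : finite_set [set: T] by exact: finite_finset.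
rewrite /counting asboolT; last exact: finite_image.
rewrite fset_set_image// card_imfset// cardE.
congr (_%:R%:E); apply/eqP; rewrite eqn_leq.
rewrite !uniq_leq_size ?enum_uniq ?fset_uniq// => x _.
  by rewrite in_fset_set// inE.
by rewrite mem_enum.
Qed.

Definition word (X : Type) (a b : X) (n : nat) (w : n.-tuple bool) :
  n.-tuple X := [tuple of map (fun c => if c then a else b) w].

Lemma tnth_word (X : Type) (a b : X) n (w : n.-tuple bool) (i : 'I_n) :
  tnth (word a b w) i = if tnth w i then a else b.
Proof. exact: tnth_map. Qed.

Lemma word_orbit (X : Type) (F : X -> set X) (a b : X) n (w : n.-tuple bool) :
  [set a; b] `<=` F a -> [set a; b] `<=` F b -> orbits F n (word a b w).
Proof.
move=> Fa Fb i j _; rewrite !tnth_word.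
have ab : [set a; b] (if tnth w j then a else b).
  by case: (tnth w j); [left|right].
by case: (tnth w i); [exact: Fa|exact: Fb].
Qed.

Lemma word_separated (R : realType) (X : metricType R) (a b : X) n
    (v w : n.-tuple bool) :
  v != w -> mdist a b <= orbit_dist (word a b v) (word a b w).
Proof.
move=> vw.
have [i vwi] : exists i, tnth v i != tnth w i.
  apply/existsP; apply: contraNT vw; rewrite negb_exists => /forallP e.
  by apply/eqP/eq_from_tnth => i; apply/eqP; rewrite -[_ == _]negbK.
apply: (bigmax_sup i) => //; rewrite !tnth_word.
by case: (tnth v i) (tnth w i) vwi => [] []// _; rewrite metric_sym.
Qed.

Lemma word_inj (X : Type) (a b : X) n : a <> b -> injective (@word X a b n).
Proof.
move=> ab v w /(congr1 val)/inj_map vw; apply/val_inj/vw.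
by case=> [] [] // /esym.
Qed.

Lemma sep_num_ge_expn2 (R : realType) (X : metricType R) (F : X -> set X)
    (a b : X) (n : nat) (eps : R) :
  a <> b -> [set a; b] `<=` F a -> [set a; b] `<=` F b ->
  eps <= mdist a b -> (((2 : R) ^+ n)%:E <= sep_num F n eps)%E.
Proof.
move=> ab Fa Fb epsd; rewrite -natrX -card_bool -card_tuple.
apply: (sep_num_ge_card (f := word a b (n := n))).
- exact: word_inj.
- by move=> w; exact: word_orbit.
- by move=> v w vw; apply: le_trans epsd _; exact: word_separated.
Qed.

Lemma entropy_at_ge_ln (R : realType) (X : metricType R) (F : X -> set X)
    (eps q : R) :
  0 < q -> (forall n, ((q ^+ n)%:E <= sep_num F n eps)%E) ->
  ((ln q)%:E <= entropy_at F eps)%E.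
Proof.
move=> q0 qF; rewrite /entropy_at limn_esup_lim.
apply: lime_ge; first exact: is_cvg_esups.
apply: nearW => n.
(* The term at 0 is 0 because [0^-1 = 0], so the supremum over the indices from
   [n] on is bounded below through its term at [n.+1]. *)
apply: (@le_trans _ _
    ((n.+1%:R^-1)%:E * lne (sep_num F n.+1 eps))%E); last first.
  by apply: ereal_sup_ubound; exists n.+1 => //=.
have <- : ((n.+1%:R^-1)%:E * lne (q ^+ n.+1)%:E)%E = (ln q)%:E.
  by rewrite lne_EFin ?exprn_gt0// lnXn// -EFinM -[ln q *+ _]mulr_natl mulKf//.
apply: lee_wpmul2l; first by rewrite lee_fin invr_ge0.
by rewrite lee_lne// in_itv/= leey andbT ?sep_num_ge0// lee_fin exprn_ge0// ltW.
Qed.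

Theorem proposition6p1 (R : realType) (X : metricType R)
    (hX : compact [set: X]) (F : X -> set X)
    (hF : forall x : X, hyperspace X (F x))
    (husc : upper_semicontinuous F)
    (a b : X) (hab : a <> b)
    (hFa : [set a; b] `<=` F a) (hFb : [set a; b] `<=` F b) :
  ((ln (2 : R))%:E <= entropy F)%E.
Proof.
have ab0 : 0 < mdist a b by rewrite mdist_gt0; apply/eqP.
apply: lime_ge; first exact: is_cvg_entropy_at.
near=> eps; apply: entropy_at_ge_ln => // n.
apply: (sep_num_ge_expn2 _ hab) => //.
by near: eps; exact: nbhs_right_le.
Unshelve. all: by end_near. Qed.
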